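(* Let $k$ be an algebraic extension of $\mathbb{F}_q$ and let $I\subseteq k[x_0,\dots,x_m]$ be the vanishing ideal over $k$ of the set $\mathbb{P}^m(\mathbb{F}_q)\subseteq \mathbb{P}^m(k)$. Then the set $\{x_i^q x_j - x_i x_j^q : 0\le i<j\le m\}$ is a reduced Gröbner basis of $I$ (with respect to the fixed monomial order $\preccurlyeq$), and it is also a universal Gröbner basis of $I$.
   Context: $q$ is a prime power, $\mathbb{F}_q$ is the finite field with $q$ elements, and $m$ is a positive integer. $\preccurlyeq$ is a fixed, otherwise arbitrary, monomial order on the set of all monomials in $x_0,\dots,x_m$ such that $x_0\succ x_1\succ\cdots\succ x_m$. The vanishing ideal over $k$ of a subset $X$ of $\mathbb{P}^m(k)$ is the ideal of $k[x_0,\dots,x_m]$ generated by the homogeneous polynomials that vanish at every point of $X$. $\mathbb{P}^m(\mathbb{F}_q)$ is regarded as the set of $\mathbb{F}_q$-rational points of $\mathbb{P}^m(k)$. A universal Gröbner basis of an ideal $I$ is a subset of $I$ that is a Gröbner basis of $I$ with respect to every monomial (term) order. *)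

(* Defs.v *)
From HB Require Import structures.
From mathcomp Require Import all_boot all_order all_algebra.
From mathcomp.multinomials Require Import mpoly.

Set Implicit Arguments.
Unset Strict Implicit.
Unset Printing Implicit Defensive.

Import GRing.Theory.
Local Open Scope ring_scope.

(* Ideal generated by a (possibly infinite) set S. *)
Definition ideal_gen (R : comNzRingType) (S : R -> Prop) (f : R) : Prop :=
  exists2 s : seq (R * R),
    forall c, c \in s -> S c.2 & f = \sum_(c <- s) c.1 * c.2.

(* Points of P^m(k), as the lines through the origin of k^(m+1). *)
Definition proj_point (k : fieldType) (m : nat) : Type :=
  {L : {vspace 'rV[k]_m.+1} | \dim L == 1%N}.

(* The nonzero vectors of the line are the homogeneous coordinates of P; for
   homogeneous f the condition does not depend on the one chosen. *)
Definition vanishes_at (k : fieldType) (m : nat)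
    (f : {mpoly k[m.+1]}) (P : proj_point k m) : Prop :=
  forall v : 'rV[k]_m.+1, v \in sval P -> v != 0 -> f.@[v 0] = 0.

Definition vanishing_ideal (k : fieldType) (m : nat)
    (X : proj_point k m -> Prop) : {mpoly k[m.+1]} -> Prop :=
  ideal_gen (fun f : {mpoly k[m.+1]} =>
    (exists d : nat, f \is d.-homog) /\ (forall P, X P -> vanishes_at f P)).

(* P^m(F) inside P^m(k): the points with homogeneous coordinates in F. *)
Definition rational_point (F k : fieldType) (iota : {rmorphism F -> k})
    (m : nat) (P : proj_point k m) : Prop :=
  exists2 u : 'rV[F]_m.+1, u != 0 & sval P = <[map_mx iota u]>%VS.

(* le a b means that a precedes or equals b; 0 is the monomial 1 and + is the
   product of monomials. *)
Record monomial_order (n : nat) (le : rel 'X_{1..n}) : Prop := MonomialOrder {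
  mo_refl  : reflexive le;
  mo_anti  : antisymmetric le;
  mo_trans : transitive le;
  mo_total : total le;
  mo_one   : forall a, le 0%MM a;
  mo_mul   : forall a b c, le a b -> le (a + c)%MM (b + c)%MM
}.

Section Groebner.
Variables (k : fieldType) (n : nat) (le : rel 'X_{1..n}).
Implicit Types (p g : {mpoly k[n]}) (I S : {mpoly k[n]} -> Prop).
Implicit Types (G : seq {mpoly k[n]}).

(* The library's mlead is tied to one particular order. For a monomial order
   le and p != 0 this is the le-largest monomial of p; lead_mon 0 is 1. *)
Definition lead_mon p : 'X_{1..n} :=
  foldr (fun a b => if le a b then b else a) 0%MM (msupp p).

Definition lead_coeff p : k := p@_(lead_mon p).

Definition lead_ideal S : {mpoly k[n]} -> Prop :=
  ideal_gen (fun t => exists p, [/\ S p, p != 0 & t = 'X_[lead_mon p]]).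

Definition groebner_basis I G : Prop :=
  (forall g, g \in G -> I g) /\
  (forall f, lead_ideal I f <-> lead_ideal (fun g => g \in G) f).

(* G is read as a finite set, hence h != g rather than a list deletion. *)
Definition reduced_groebner_basis I G : Prop :=
  [/\ groebner_basis I G,
      forall g, g \in G -> lead_coeff g = 1
    & forall g, g \in G -> forall a, a \in msupp g ->
        ~ lead_ideal (fun h => h \in G /\ h != g) 'X_[a]].

End Groebner.

Definition universal_groebner_basis (k : fieldType) (n : nat)
    (I : {mpoly k[n]} -> Prop) (G : seq {mpoly k[n]}) : Prop :=
  (forall g, g \in G -> I g) /\
  (forall le : rel 'X_{1..n}, monomial_order le -> groebner_basis le I G).

Definition frobenius_binomials (k : fieldType) (q m : nat) :
    seq {mpoly k[m.+1]} :=
  [seq 'X_ij.1 ^+ q * 'X_ij.2 - 'X_ij.1 * 'X_ij.2 ^+ q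
    | ij : 'I_m.+1 * 'I_m.+1 <- enum {: 'I_m.+1 * 'I_m.+1} & (ij.1 < ij.2)%N].

(* Main.v *)
Require Import Defs.
From HB Require Import structures.
From mathcomp Require Import all_boot all_order all_algebra.
From mathcomp Require Import finfield zify.
From mathcomp.multinomials Require Import mpoly.

Set Implicit Arguments.
Unset Strict Implicit.
Unset Printing Implicit Defensive.

Import GRing.Theory.
Local Open Scope ring_scope.

(* Let f be in I with leading monomial b, and suppose that no x_i^q x_j with
   x_j < x_i divides b. Every homogeneous part of f vanishes on F_q^(m+1), where
   only the exponents reduced modulo q - 1 matter, and reduced monomials are
   linearly independent functions; so the coefficients of the monomials a of
   degree deg b with the same reduction as b sum to 0. Such an a has the same
   variables as b, and b is reduced except in its smallest variable, so a arises
   from b by trading that variable for larger ones, whence a >= b. Hence b is the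
   only such monomial in the support of f, and its coefficient is 0, which is a
   contradiction. *)

(** * Ideals given by generators, and their monomials *)

Lemma ideal_gen_sub (R : comNzRingType) (S T : R -> Prop) :
  (forall f, S f -> ideal_gen T f) -> forall f, ideal_gen S f -> ideal_gen T f.
Proof.
move=> ST f [s]; elim: s f => [|c s IHs] f sS ->.
  by exists [::] => //; rewrite !big_nil.
rewrite big_cons.
have [|t1 t1T ->] := ST c.2; first by apply: sS; rewrite mem_head.
have [|t2 t2T ->] := IHs _ _ (erefl _).
  by move=> d ds; apply: sS; rewrite inE ds orbT.
exists ([seq (c.1 * d.1, d.2) | d <- t1] ++ t2).
  move=> d; rewrite mem_cat => /orP[/mapP[d' d't1 ->]|]; last exact: t2T.
  exact: (t1T d').
rewrite big_cat big_map mulr_sumr; congr (_ + _).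
by apply: eq_bigr => d _; rewrite mulrA.
Qed.

Lemma ideal_gen_mem (R : comNzRingType) (S : R -> Prop) (f : R) :
  S f -> ideal_gen S f.
Proof.
move=> Sf; exists [:: (1, f)]; last by rewrite big_seq1 mul1r.
by move=> c; rewrite inE => /eqP ->.
Qed.

(** The coefficient 1 at [a] must come from some summand, and the support of a multiple of ['X_[b]]
    consists of multiples of [b]. This turns membership in a leading ideal into divisibility. *)
Lemma monomial_in_ideal (k : fieldType) (n : nat) (B : 'X_{1..n} -> Prop)
    (a : 'X_{1..n}) :
  ideal_gen (fun t : {mpoly k[n]} => exists2 b, B b & t = 'X_[b]) 'X_[a] ->
  exists2 b, B b & (b <= a)%MM.
Proof.
case=> s sB /(congr1 (mcoeff a)); rewrite mcoeffX eqxx raddf_sum /= => def1.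
have [/hasP[c cs]|/hasPn coef0] := boolP (has (fun c => (c.1 * c.2)@_a != 0) s).
  have [b Bb ->] := sB _ cs; rewrite -mcoeff_msupp => a_supp; exists b => //.
  move/msuppM_le: a_supp => /allpairsP[[u v] /= [_]].
  by rewrite msuppX inE => /eqP -> ->; apply: lem_addl.
case/eqP: (oner_neq0 k); rewrite [LHS]def1 big_seq big1 // => c /coef0.
by rewrite negbK => /eqP.
Qed.

(** * Leading monomials for an arbitrary monomial order *)

Section MonomialOrder.
Variables (n : nat) (le : rel 'X_{1..n}).
Hypothesis le_mo : monomial_order le.

Lemma mo_addm a b c d : le a b -> le c d -> le (a + c)%MM (b + d)%MM.
Proof.
move=> le_ab le_cd; apply: (mo_trans le_mo) (mo_mul le_mo c le_ab) _.
by rewrite ![(b + _)%MM]addmC; apply: mo_mul.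
Qed.

Lemma mo_muln a b r : le a b -> le (a *+ r)%MM (b *+ r)%MM.
Proof.
move=> le_ab; elim: r => [|r IHr]; first exact: mo_refl.
by rewrite !mulmS; apply: mo_addm.
Qed.

Lemma le_lead_mon (k : fieldType) (p : {mpoly k[n]}) a :
  a \in msupp p -> le a (lead_mon le p).
Proof.
rewrite /lead_mon; elim: {p}(msupp p : seq _) => //= b s.
set l := foldr _ _ s => IHs; have := mo_total le_mo b l.
rewrite inE; case: ifP => /= [le_bl _ /orP[/eqP -> //|/IHs //]|_ le_lb].
case/orP=> [/eqP ->|/IHs le_al]; first exact: mo_refl.
exact: mo_trans le_al le_lb.
Qed.

Lemma lead_mon_msupp (k : fieldType) (p : {mpoly k[n]}) :
  p != 0 -> lead_mon le p \in msupp p.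
Proof.
rewrite -msupp_eq0 /lead_mon; elim: {p}(msupp p : seq _) => //= b s IHs _.
have [->|/IHs s_in] := eqVneq s [::]; case: ifP => //= le_b;
  rewrite inE ?eqxx ?s_in ?orbT //.
(* The default [0%MM] of the fold survives only if [b] lies below it, and then [b] equals it,
   because 1 is the least monomial. *)
by apply/eqP/(mo_anti le_mo); rewrite le_b (mo_one le_mo).
Qed.

Lemma msupp_binomial (k : fieldType) (a b : 'X_{1..n}) c : a != b ->
  (c \in msupp ('X_[a] - 'X_[b] : {mpoly k[n]})) = (c == a) || (c == b).
Proof.
move=> ab; rewrite mcoeff_msupp mcoeffB !mcoeffX !(eq_sym c).
have [<-|_] := eqVneq a c; first by rewrite (eq_sym b) (negPf ab) subr0 oner_eq0.
by rewrite sub0r oppr_eq0; case: (b == c); rewrite ?oner_eq0 ?eqxx.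
Qed.

Lemma binomial_neq0 (k : fieldType) (a b : 'X_{1..n}) : a != b ->
  'X_[a] - 'X_[b] != 0 :> {mpoly k[n]}.
Proof.
move=> ab; rewrite -msupp_eq0; have := msupp_binomial k a ab.
by rewrite eqxx; case: (msupp _).
Qed.

Lemma lead_mon_binomial (k : fieldType) (a b : 'X_{1..n}) : a != b ->
  lead_mon le ('X_[a] - 'X_[b] : {mpoly k[n]}) = if le a b then b else a.
Proof.
move=> ab; have := lead_mon_msupp (binomial_neq0 k ab).
have := le_lead_mon (p := 'X_[a] - 'X_[b] : {mpoly k[n]}) (a := a).
have := le_lead_mon (p := 'X_[a] - 'X_[b] : {mpoly k[n]}) (a := b).
rewrite !msupp_binomial // !eqxx orbT => /(_ isT) le_b /(_ isT) le_a.
case/orP=> /eqP eq_l; rewrite eq_l in le_a le_b *; last by rewrite le_a.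
by case: ifP => // le_ab; apply: (mo_anti le_mo); rewrite le_ab le_b.
Qed.

(* [b] is obtained from [a] by trading variables x_i for the smaller x_l. *)
Lemma mo_transfer (l : 'I_n) (a b : 'X_{1..n}) :
  mdeg a = mdeg b -> (forall i, i != l -> (b i <= a i)%N) ->
  (forall i, a i != 0%N -> le U_(l)%MM U_(i)%MM) -> le b a.
Proof.
move=> deg_ab le_ba le_l.
(* [c] is the part common to [a] and [b], and [d] the part of [a] that is traded; by degree, [b] is
   [c] times the power [mdeg d] of x_l. *)
pose c := [multinom if i == l then a l else b i | i < n].
pose d := [multinom if i == l then 0%N else (a i - b i)%N | i < n].
have a_cd : a = (d + c)%MM.
  apply/mnmP=> i; rewrite mnmDE !mnmE; case: (eqVneq i l) => [->|/le_ba] //.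
  by lia.
have b_cd : b = (U_(l) *+ mdeg d + c)%MM.
  have degb : mdeg b = (mdeg d + \sum_i c i)%N by rewrite -deg_ab a_cd mdegD -mdegE.
  have eq_off : (\sum_(i | i != l) b i = \sum_(i | i != l) c i)%N.
    by apply: eq_bigr => i /negPf il; rewrite mnmE il.
  move: degb; rewrite mdegE !(bigD1 l (P := predT)) //= eq_off mnmE eqxx.
  rewrite addnA => /addIn degb.
  apply/mnmP=> i; rewrite mnmDE mulmnE mnm1E; case: (eqVneq l i) => [<-|il].
    by rewrite mnmE eqxx mul1n degb.
  by rewrite mnmE eq_sym (negPf il).
rewrite a_cd b_cd; apply: mo_mul => //.
have -> : (U_(l) *+ mdeg d = \sum_(i < n) U_(l) *+ d i)%MM.
  apply/mnmP=> j; rewrite mulmnE mnm_sumE mdegE big_distrr /=.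
  by apply: eq_bigr => i _; rewrite mulmnE.
rewrite [X in le _ X]multinomUE_id.
apply: (big_ind2 le) => [|a1 b1 a2 b2|i _]; [exact: mo_refl|exact: mo_addm|].
have [->|d_i] := eqVneq (d i) 0%N; first exact: mo_refl.
apply: mo_muln; apply: le_l; apply: contraNneq d_i => a_i.
by rewrite mnmE a_i sub0n; case: ifP.
Qed.

End MonomialOrder.

(* On F_q the power maps x^j and x^(red_exp q j) agree: exponents matter modulo
   q - 1, except that a positive exponent must stay positive because of x = 0. *)
Definition red_exp (q j : nat) : nat := if j is i.+1 then (i %% q.-1).+1 else 0%N.

Lemma red_exp_le q j : (red_exp q j <= j)%N.
Proof. by case: j => // j; rewrite ltnS leq_mod. Qed.

Lemma red_exp_small q j : (j < q)%N -> red_exp q j = j.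
Proof. by case: j => // j ltjq; rewrite /= modn_small //; lia. Qed.

Lemma red_exp_lt q j : (1 < q)%N -> (red_exp q j < q)%N.
Proof.
case: j => [|j] q1; first exact: ltnW.
by have := @ltn_pmod j q.-1; rewrite /=; lia.
Qed.

Lemma red_exp_eq0 q j : (red_exp q j == 0)%N = (j == 0)%N.
Proof. by case: j. Qed.

(** * Monomials as functions on a finite field *)

Section FiniteField.
Variable F : finFieldType.
Local Notation q := #|F|.

Lemma exp_red_exp (x : F) j : x ^+ red_exp q j = x ^+ j.
Proof.
case: j => // j; rewrite !exprS.
have [->|x0] := eqVneq x 0; first by rewrite !mul0r.
have xq : x ^+ q.-1 = 1.
  apply: (mulfI x0); rewrite -exprS mulr1 prednK ?expf_card //.
  by apply/card_gt0P; exists 0.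
by rewrite [in RHS](divn_eq j q.-1) exprD mulnC exprM xq expr1n mul1r.
Qed.

(** The powers below [q], taken at all elements of [F], form an invertible Vandermonde matrix;
    column [c] of its inverse is the weight. *)
Lemma dual_power_weight (c : nat) : (c < q)%N ->
  exists w : F -> F, forall j, \sum_x w x * x ^+ j = (red_exp q j == c)%:R.
Proof.
move=> ltcq; pose V := Vandermonde q (\row_(i < q) (enum_val i : F)).
have uV : V \in unitmx.
  rewrite unitmxE det_Vandermonde unitfE; apply/prodf_neq0 => i _.
  apply/prodf_neq0 => j ltij; rewrite !mxE subr_eq0.
  by apply: contraTneq ltij => /enum_val_inj ->; rewrite ltnn.
exists (fun x => invmx V (enum_rank x) (Ordinal ltcq)) => j.
have ltjq : (red_exp q j < q)%N by apply/red_exp_lt/finNzRing_gt1.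
have /matrixP/(_ (Ordinal ltjq) (Ordinal ltcq)) := mulmxV uV.
rewrite !mxE -val_eqE /= => <-; rewrite (reindex (enum_val (A := F))) /=.
  apply: eq_bigr => i _; rewrite !mxE enum_valK mulrC; congr (_ * _).
  by rewrite exp_red_exp.
by exists enum_rank => i _; [apply: enum_valK|apply: enum_rankK].
Qed.

Variables (k : fieldType) (iota : {rmorphism F -> k}).

(** Sum the values of [g] against a product of dual weights, one per variable. A monomial
    contributes 1 if its exponents reduce to [c] and 0 otherwise, while the whole sum is 0. *)
Lemma sum_mcoeff_red_exp n (g : {mpoly k[n]}) (c : 'I_n -> nat) :
  (forall i, c i < q)%N ->
  (forall u : 'rV[F]_n, g.@[(map_mx iota u) 0] = 0) ->
  \sum_(a <- msupp g | [forall i, red_exp q (a i) == c i]) g@_a = 0.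
Proof.
move=> ltcq g0.
have [w wP] := fin_all_exists (fun i => dual_power_weight (ltcq i)).
pose W (u : {ffun 'I_n -> F}) := iota (\prod_i w i (u i)).
have : \sum_u W u * g.@[(map_mx iota (\row_i u i)) 0] = 0.
  by rewrite big1 // => u _; rewrite g0 mulr0.
under eq_bigr do rewrite mevalE mulr_sumr.
rewrite exchange_big => sum0; rewrite -[RHS]sum0 big_mkcond.
apply: eq_bigr => a _ /=.
transitivity (g@_a * iota (\sum_(u : {ffun 'I_n -> F})
    \prod_i (w i (u i) * u i ^+ a i))); last first.
  rewrite rmorph_sum mulr_sumr; apply: eq_bigr => u _.
  rewrite mulrCA big_split rmorphM /=; congr (_ * (_ * _)).
  by rewrite rmorph_prod; apply: eq_bigr => i _; rewrite !mxE rmorphXn.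
rewrite -(bigA_distr_bigA (fun i x => w i x * x ^+ a i)).
case: ifP => [/forallP all_c|/negbT].
  rewrite big1 ?rmorph1 ?mulr1 // => i _.
  by rewrite wP (eqP (all_c i)) eqxx.
rewrite negb_forall => /existsP[i neq_c].
by rewrite (bigD1 i) //= wP (negPf neq_c) mul0r rmorph0 mulr0.
Qed.

End FiniteField.

(** * Homogeneous polynomials and components *)

Lemma dhomog_meval_scale (k : fieldType) n d (f : {mpoly k[n]}) t (v : 'rV_n) :
  f \is d.-homog -> f.@[(t *: v) 0] = t ^+ d * f.@[v 0].
Proof.
move=> /dhomogP homf; rewrite !mevalE mulr_sumr big_seq [RHS]big_seq.
apply: eq_bigr => a /homf <- /=; rewrite mulrCA; congr (_ * _).
rewrite mdegE; under eq_bigr do rewrite mxE exprMn.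
by rewrite big_split -prodrXr.
Qed.

Lemma mcoeff_pihomog (k : fieldType) n (f : {mpoly k[n]}) a :
  (pihomog mdeg (mdeg a) f)@_a = f@_a.
Proof.
(* The bound also exceeds [mdeg a], so that this degree occurs in the partition even when it is
   beyond the degree of [f]. *)
pose N := maxn (msize f) (mdeg a).+1.
have ltaN : (mdeg a < N)%N by rewrite leq_maxr.
have fN : (mmeasure mdeg f <= N)%N by rewrite leq_maxl.
rewrite [X in _ = X@_a](pihomog_partitionE fN) [RHS]raddf_sum.
rewrite (bigD1 (Ordinal ltaN)) //=.
rewrite [X in _ + X]big1 ?addr0 // => i neq_i.
apply: (dhomog_nemf_coeff (pihomogP mdeg i f)).
by apply: contraNneq neq_i => eq_i; apply/eqP/val_inj.
Qed.

(** * The vanishing ideal of the rational points *)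

Section RationalPoints.
Variables (F : finFieldType) (k : fieldType) (iota : {rmorphism F -> k}).
Variable m : nat.
Local Notation q := #|F|.
Local Notation I := (vanishing_ideal (rational_point iota (m := m))).
Implicit Types (f : {mpoly k[m.+1]}) (a b : 'X_{1..m.+1}).

Lemma dhomog_vanishing d f (u : 'rV[F]_m.+1) : f \is d.-homog ->
  (forall P, rational_point iota P -> vanishes_at f P) ->
  f.@[(map_mx iota u) 0] = 0.
Proof.
move=> homf f0.
have f_nz (v : 'rV[F]_m.+1) : v != 0 -> f.@[(map_mx iota v) 0] = 0.
  move=> v0; have v0' : map_mx iota v != 0 by rewrite map_mx_eq0.
  have dimv : \dim <[map_mx iota v]> == 1%N by rewrite dim_vline v0'.
  apply: (f0 (exist _ <[map_mx iota v]>%VS dimv)) => //; last exact: memv_line.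
  by exists v.
have [->|/f_nz//] := eqVneq u 0.
(* The origin represents no projective point. Scaling a nonzero vector by 0 reaches it, and this
   works for [d = 0] too, since [f] is already 0 at that vector. *)
have -> : map_mx iota 0 = 0 *: map_mx iota (const_mx 1) :> 'rV_m.+1.
  by rewrite scale0r map_mx0.
rewrite (dhomog_meval_scale _ _ homf) f_nz ?mulr0 //.
by apply/eqP => /rowP/(_ 0) /eqP; rewrite !mxE oner_eq0.
Qed.

Lemma vanishing_pihomog f d (u : 'rV[F]_m.+1) : I f ->
  (pihomog mdeg d f).@[(map_mx iota u) 0] = 0.
Proof.
case=> s sI ->; rewrite (linear_sum (pihomog mdeg d)) raddf_sum big_seq.
rewrite big1 //= => -[g h].
case/sI=> -[e homh] /(dhomog_vanishing u homh) h0 /=.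
(* With the multiplier [g] split by degree, each product with [h] is homogeneous: it either has
   degree [d] and vanishes with [h], or projects to 0. *)
rewrite (pihomog_partitionE (leqnn (mmeasure mdeg g))) mulr_suml.
rewrite (linear_sum (pihomog mdeg d)) raddf_sum big1 //= => i _.
have homih := dhomogM (pihomogP mdeg i g) homh.
have [eq_d|neq_d] := eqVneq (i + e)%N d.
  by rewrite pihomog_dE -?eq_d // mevalM h0 mulr0.
by rewrite (pihomog_ne0 neq_d homih) meval0.
Qed.

Variable le : rel 'X_{1..m.+1}.
Hypothesis le_mo : monomial_order le.

Definition fmon (i j : 'I_m.+1) : 'X_{1..m.+1} := (U_(i) *+ q + U_(j))%MM.

Lemma standard_mon_min a b :
  (forall i j, i != j -> le U_(j)%MM U_(i)%MM -> ~~ (fmon i j <= b)%MM) ->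
  mdeg a = mdeg b -> (forall i, red_exp q (a i) = red_exp q (b i)) -> le b a.
Proof.
move=> std deg_ab red_ab.
have supp_ab i : (a i == 0)%N = (b i == 0)%N.
  by rewrite -(red_exp_eq0 q) red_ab red_exp_eq0.
have [i0 b_i0|b0] := pickP (fun i => b i != 0%N); last first.
  have -> : b = 0%MM by apply/mnmP=> i; rewrite mnm0E; apply/eqP/negbFE/b0.
  exact: mo_one.
have refl_U : reflexive le by apply: mo_refl.
(* The witness [l] is the [le]-smallest variable occurring in [b]. *)
have [] := @extremumP _ _ le i0 (fun i => b i != 0%N) (fun i => U_(i)%MM)
  refl_U (mo_trans le_mo) (mo_total le_mo) b_i0.
move=> l b_l le_l; apply: (mo_transfer le_mo (l := l)) => //.
  move=> i neq_il; have [->//|b_i] := eqVneq (b i) 0%N.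
  (* Once [b i < q], the exponent [b i] is the reduction of [a i], hence at most [a i]. If
     [q <= b i], then [fmon i l] would divide [b], as x_l occurs in it. *)
  rewrite -(@red_exp_small q (b i)) -?red_ab ?red_exp_le // ltnNge.
  apply: contra (std i l neq_il (le_l i b_i)) => le_q.
  apply/mnm_lepP=> j; rewrite mnmDE mulmnE !mnm1E.
  have [<-|_] := eqVneq i j; first by rewrite eq_sym (negPf neq_il); lia.
  by case: eqP => [<-|]; lia.
by move=> i; rewrite supp_ab; apply: le_l.
Qed.

(** The pair is oriented by [le] rather than by index, so that the result serves every monomial
    order. *)
Lemma lead_mon_vanishing f : I f -> f != 0 ->
  exists i j, [/\ i != j, le U_(j)%MM U_(i)%MM & (fmon i j <= lead_mon le f)%MM].
Proof.
move=> If f0; set b := lead_mon le f.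
case: (boolP [exists i, exists j,
  [&& i != j, le U_(j)%MM U_(i)%MM & (fmon i j <= b)%MM]]).
  by case/existsP=> i /existsP[j] /and3P[? ? ?]; exists i, j.
rewrite negb_exists => /forallP std.
have q1 : (1 < q)%N := finNzRing_gt1 F.
set g := pihomog mdeg (mdeg b) f.
have g_b : g@_b = f@_b by apply: mcoeff_pihomog.
have b_f : b \in msupp f := lead_mon_msupp le_mo f0.
have b_g : b \in msupp g by rewrite mcoeff_msupp g_b -mcoeff_msupp.
have := sum_mcoeff_red_exp (c := fun i => red_exp q (b i))
  (fun i => red_exp_lt (b i) q1) (fun u => vanishing_pihomog (mdeg b) u If).
rewrite -/g big_mkcond (bigD1_seq b) ?msupp_uniq //= ifT; last exact/forallP.
rewrite big_seq_cond big1 => [/eqP|a].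
  by rewrite addr0 g_b mcoeff_eq0 b_f.
(* Any other monomial [a] of the same class is both below [b], which leads [f], and above it by
   minimality of standard monomials. *)
case/andP=> a_g neq_ab; case: ifP => // /forallP red_ab; case/eqP: neq_ab.
have deg_ab : mdeg a = mdeg b := dhomog_mf (pihomogP mdeg (mdeg b) f) a_g.
apply: (mo_anti le_mo); apply/andP; split.
  apply: le_lead_mon => //.
  by rewrite mcoeff_msupp -mcoeff_pihomog deg_ab -mcoeff_msupp.
apply: standard_mon_min => // [i j neq_ij le_ji|i]; last exact/eqP.
apply: contra (std i) => dvd_b; apply/existsP; exists j.
by rewrite neq_ij le_ji.
Qed.

Lemma fmon_neq i j : i != j -> fmon i j != fmon j i.
Proof.
move=> neq_ij; apply/eqP => /mnmP/(_ i).
rewrite !mnmDE !mulmnE !mnm1E eqxx (eq_sym j) (negPf neq_ij) mul1n mul0n addn0.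
by move=> eq_q; have := finNzRing_gt1 F; rewrite eq_q.
Qed.

(** Both monomials are x_i x_j times the power [q - 1] of one variable, so comparing the variables
    suffices. *)
Lemma fmon_swap_le i j : le U_(j)%MM U_(i)%MM -> le (fmon j i) (fmon i j).
Proof.
move=> le_ji; have q0 : (0 < q)%N := ltnW (finNzRing_gt1 F).
have fmonE i' j' : fmon i' j' = (U_(i') *+ q.-1 + (U_(i') + U_(j')))%MM.
  by rewrite /fmon -(prednK q0) mulmSr prednK // addmA.
by rewrite !fmonE [(U_(j) + _)%MM]addmC; apply/mo_mul/mo_muln.
Qed.

Lemma frobenius_binomialsP f :
  reflect (exists i j : 'I_m.+1, (i < j)%N /\ f = 'X_[fmon i j] - 'X_[fmon j i])
    (f \in frobenius_binomials k q m).
Proof.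
have fE i j : 'X_i ^+ q * 'X_j - 'X_i * 'X_j ^+ q
    = 'X_[fmon i j] - 'X_[fmon j i] :> {mpoly k[m.+1]}.
  by rewrite !mpolyXn -!mpolyXD [(U_(i) + _)%MM]addmC.
apply: (iffP mapP) => [[[i j] /=]|[i [j [ltij ->]]]].
  by rewrite mem_filter /= => /andP[ltij _] ->; exists i, j; rewrite fE.
by exists (i, j); rewrite ?fE // mem_filter /= ltij mem_enum.
Qed.

Lemma frobenius_binomials_vanish f : f \in frobenius_binomials k q m -> I f.
Proof.
case/frobenius_binomialsP=> i [j [ltij ->]]; apply: ideal_gen_mem; split.
  exists q.+1; have homX i' j' : ('X_[fmon i' j'] : {mpoly k[m.+1]}) \is q.+1.-homog.
    by rewrite dhomogX /= mdegD mdegMn !mdeg1 mul1n addn1.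
  by apply: rpredB.
move=> P [u _ defP] v; rewrite defP => /vlineP[t ->] _.
(* Coordinates of a rational point are a vector over [F] up to a scalar [t] of [k]. Homogeneity
   isolates [t], and the power [q] fixes the entries of [u]. *)
have evX i' j' : ('X_[fmon i' j'] : {mpoly k[m.+1]}).@[(t *: map_mx iota u) 0]
    = t ^+ q.+1 * iota (u 0 i' * u 0 j').
  rewrite mpolyXD -mpolyXn mevalM rmorphXn /= !mevalXU !mxE exprMn.
  by rewrite -rmorphXn expf_card exprSr rmorphM mulrACA.
by rewrite mevalB !evX [u 0 j * _]mulrC subrr.
Qed.

Lemma frobenius_groebner : groebner_basis le I (frobenius_binomials k q m).
Proof.
split=> [f|f]; first exact: frobenius_binomials_vanish.
split; apply: ideal_gen_sub => _ [g [Ig g0 ->]]; last first.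
  by apply: ideal_gen_mem; exists g; split=> //; apply: frobenius_binomials_vanish.
have [i [j [neq_ij le_ji dvd_g]]] := lead_mon_vanishing Ig g0.
exists [:: ('X_[lead_mon le g - fmon i j], 'X_[fmon i j])]; last first.
  by rewrite big_seq1 -mpolyXD submK.
move=> c; rewrite inE => /eqP -> /=.
have neqm := fmon_neq neq_ij; have le_mon := fmon_swap_le le_ji.
case: (ltngtP i j) => [ltij|ltji|/val_inj eq_ij];
  last by rewrite eq_ij eqxx in neq_ij.
  exists ('X_[fmon i j] - 'X_[fmon j i]); split.
  - by apply/frobenius_binomialsP; exists i, j.
  - exact: binomial_neq0.
  rewrite lead_mon_binomial //; case: ifP => // le_mon'.
  by congr 'X_[_]; apply: (mo_anti le_mo); rewrite le_mon le_mon'.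
(* For [j < i] the list holds the opposite binomial, whose leading monomial is the same. *)
exists ('X_[fmon j i] - 'X_[fmon i j]); split.
- by apply/frobenius_binomialsP; exists j, i.
- by apply: binomial_neq0; rewrite eq_sym.
by rewrite lead_mon_binomial 1?eq_sym // le_mon.
Qed.

End RationalPoints.

(** * Reducedness of the basis *)

Lemma fmon_dvd_inj (F : finFieldType) (m : nat) (s t i j : 'I_m.+1) :
  s != t -> i != j -> (fmon F s t <= fmon F i j)%MM -> s = i /\ t = j.
Proof.
move=> neq_st neq_ij /mnm_lepP dvd; have q1 := finNzRing_gt1 F.
(* The exponent of x_s is [q > 1] on the left, but at most 1 on the right unless [s = i]. The
   exponent of x_t then forces [t = j]. *)
have eq_si : s = i.
  apply/eqP; apply: contraLR (dvd s) => neq_si; rewrite -ltnNge.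
  rewrite !mnmDE !mulmnE !mnm1E eqxx (eq_sym i) (negPf neq_si) mul1n mul0n.
  rewrite (eq_sym t) (negPf neq_st) addn0.
  by apply: leq_ltn_trans q1; apply: leq_b1.
split=> //; apply/eqP; apply: contraLR (dvd t) => neq_tj; rewrite -ltnNge.
rewrite !mnmDE !mulmnE !mnm1E -eq_si eqxx (negPf neq_st) (eq_sym j).
by rewrite (negPf neq_tj).
Qed.

Theorem theorem2p8 (p e q m : nat) (p_prime : prime p) (e_gt0 : (0 < e)%N)
    (q_def : q = (p ^ e)%N) (m_gt0 : (0 < m)%N)
    (F : finFieldType) (cardF : #|F| = q)
    (k : fieldType) (iota : {rmorphism F -> k})
    (k_alg : forall x : k, algebraicOver iota x)
    (le : rel 'X_{1..m.+1}) (le_mo : monomial_order le)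
    (le_vars : forall i j : 'I_m.+1, (i < j)%N ->
       le U_(j)%MM U_(i)%MM /\ U_(j)%MM <> U_(i)%MM :> 'X_{1..m.+1}) :
  let I := vanishing_ideal (rational_point iota (m := m)) in
  reduced_groebner_basis le I (frobenius_binomials k q m) /\
  universal_groebner_basis I (frobenius_binomials k q m).
Proof.
move=> I; rewrite -cardF {p e q p_prime e_gt0 q_def cardF k_alg m_gt0}.
split; last first.
  split=> [g|le' le'_mo]; first exact: frobenius_binomials_vanish.
  exact: frobenius_groebner.
have ord_neq (i j : 'I_m.+1) : (i < j)%N -> i != j.
  by move=> ltij; rewrite -val_eqE /= neq_ltn ltij.
have leadE (i j : 'I_m.+1) : (i < j)%N ->
    lead_mon le ('X_[fmon F i j] - 'X_[fmon F j i] : {mpoly k[m.+1]}) = fmon F i j.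
  move=> ltij; have [le_ji _] := le_vars i j ltij.
  rewrite lead_mon_binomial ?fmon_neq ?ord_neq //; case: ifP => // le_ij.
  by apply: (mo_anti le_mo); rewrite le_ij fmon_swap_le.
split; first exact: frobenius_groebner.
  move=> g /frobenius_binomialsP[i [j [ltij ->]]].
  have neqm := fmon_neq F (ord_neq i j ltij).
  rewrite /lead_coeff leadE // mcoeffB !mcoeffX eqxx.
  by rewrite [_ == fmon F i j]eq_sym (negPf neqm) subr0.
move=> g /frobenius_binomialsP[i [j [ltij ->]]] a a_g in_lead.
pose B b := exists s t : 'I_m.+1,
  [/\ (s < t)%N, (s, t) != (i, j) & b = fmon F s t].
(* The leading monomials of the other binomials are the [fmon s t] with [(s, t)] different from
   [(i, j)], so one of these divides [a]. *)
have [b [s [t [ltst neq_st ->]]]] : exists2 b, B b & (b <= a)%MM.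
  apply: (@monomial_in_ideal k); apply: ideal_gen_sub in_lead.
  move=> _ [_ [[/frobenius_binomialsP[s [t [ltst ->]]] neq_g] _ ->]].
  apply: ideal_gen_mem; rewrite leadE //; exists (fmon F s t) => //.
  by exists s, t; split=> //; apply: contraNneq neq_g => -[-> ->].
have neq_ij := ord_neq i j ltij; have neq_s_t := ord_neq s t ltst.
move: a_g; rewrite msupp_binomial ?fmon_neq // => /orP[] /eqP ->.
  case/(fmon_dvd_inj neq_s_t neq_ij) => eq_s eq_t.
  by rewrite eq_s eq_t eqxx in neq_st.
(* For the trailing monomial, divisibility gives [s = j] and [t = i], against [s < t]. *)
rewrite eq_sym in neq_ij; case/(fmon_dvd_inj neq_s_t neq_ij) => eq_s eq_t.
by rewrite eq_s eq_t ltnNge (ltnW ltij) in ltst.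
Qed.
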